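(* Let $p\ge n+1$ and let $(l_1,\dots,l_p)$ be a generic family of linear forms on $\mathbf{C}^n$ (every subfamily of $n$ elements has rank $n$). Then the polynomial $$\prod_{j=1}^{p}(s_j+1)\ \prod_{k=0}^{2(p-n)+n-2}(s_1+s_2+\cdots+s_p+n+k)$$ belongs to the Bernstein ideal $\mathcal{B}(l_1,\dots,l_p)$.
   Context: Let $A_n(\mathbf{C})$ be the Weyl algebra of differential operators with coefficients in $\mathbf{C}[x_1,\dots,x_n]$. For nonzero polynomials $f_1,\dots,f_p\in\mathbf{C}[x_1,\dots,x_n]$, the symbol $f_1^{s_1}\cdots f_p^{s_p}$ generates a free rank-one module over $\mathbf{C}[x_1,\dots,x_n,s_1,\dots,s_p,\frac{1}{f_1\cdots f_p}]$, on which $A_n(\mathbf{C})[s_1,\dots,s_p]$ (the $s_i$ being central variables) acts by $\partial_{x_k}(g\, f_1^{s_1}\cdots f_p^{s_p})=\bigl(\partial_{x_k}g+g\sum_i s_i\frac{\partial_{x_k}f_i}{f_i}\bigr)f_1^{s_1}\cdots f_p^{s_p}$. One sets $f_1^{s_1+1}\cdots f_p^{s_p+1}=f_1\cdots f_p\, f_1^{s_1}\cdots f_p^{s_p}$. The Bernstein ideal $\mathcal{B}(f_1,\dots,f_p)$ is the ideal of all $b\in\mathbf{C}[s_1,\dots,s_p]$ such that $b(s_1,\dots,s_p)\,f_1^{s_1}\cdots f_p^{s_p}\in A_n(\mathbf{C})[s_1,\dots,s_p]\,f_1^{s_1+1}\cdots f_p^{s_p+1}$. *)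

(* Defs.v *)
From HB Require Import structures.
From mathcomp Require Import all_boot all_order all_algebra.
From mathcomp Require Import fraction ring boolp reals complex mpoly.

Set Implicit Arguments.
Unset Strict Implicit.
Unset Printing Implicit Defensive.

Import GRing.Theory.
Local Open Scope ring_scope.
Local Open Scope quotient_scope.

Local Notation tofrac := (@FracField.tofrac _).

Lemma quotient_rule_wd (S : comNzRingType) (a b c d a' b' c' d' : S) :
  c * b = a * d -> c' * b + c * b' = a' * d + a * d' ->
  (c' * d - c * d') * b ^+ 2 = (a' * b - a * b') * d ^+ 2.
Proof.
move=> e e'.
have -> : (c' * d - c * d') * b ^+ 2
  = b * d * (c' * b + c * b') - (c * b) * (d * b' + b * d') by ring.
by rewrite e' e; ring.
Qed.

Lemma frac_numden (A : idomainType) (x : {ratio A}) :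
  \pi_({fraction A}) x = tofrac \n_x / tofrac \d_x.
Proof.
change (\pi_({fraction A}) x =
  FracField.mul (tofrac \n_x) (FracField.inv (tofrac \d_x))).
rewrite !piE /FracField.mulf /FracField.invf.
by rewrite !numden_Ratio ?oner_eq0 ?denom_ratioP // mulr1 mul1r Ratio_numden.
Qed.

Lemma frac_eq_cross (A : idomainType) (a b c d : A) : b != 0 -> d != 0 ->
  tofrac a / tofrac b = tofrac c / tofrac d <-> a * d = c * b.
Proof.
move=> b0 d0; split=> [/eqP|e]; last apply/eqP.
  by rewrite eqr_div ?tofrac_eq0 // -!tofracM tofrac_eq => /eqP.
by rewrite eqr_div ?tofrac_eq0 // -!tofracM e.
Qed.

(* The localization A[1/F] of a domain A, as a subring of its fraction field.
   (For F = 0 it degenerates to A, since 0^-1 = 0.) *)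
Section Localization.
Variables (A : idomainType) (F : A).

Definition loc_pred : {pred {fraction A}} :=
  fun g => `[< exists a N, g = tofrac a / tofrac F ^+ N >].

Lemma loc_predP g :
  reflect (exists a N, g = tofrac a / tofrac F ^+ N) (g \in loc_pred).
Proof. exact: asboolP. Qed.

Lemma loc_pred_tofrac a : tofrac a \in loc_pred.
Proof. by apply/loc_predP; exists a, 0; rewrite expr0 divr1. Qed.

Lemma loc_pred_degenerate g :
  F = 0 -> g \in loc_pred -> exists a, g = tofrac a.
Proof.
move=> F0 /loc_predP[a [[|N] ->]]; first by exists a; rewrite expr0 divr1.
by exists 0; rewrite F0 !rmorph0 expr0n invr0 mulr0.
Qed.

Lemma loc_subring_closed : subring_closed loc_pred.
Proof.
have [F0|F0] := eqVneq F 0.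
  split=> [|_ _ /(loc_pred_degenerate F0)[a ->] /(loc_pred_degenerate F0)[b ->]
           |_ _ /(loc_pred_degenerate F0)[a ->] /(loc_pred_degenerate F0)[b ->]].
  - by rewrite -tofrac1 loc_pred_tofrac.
  - by rewrite -tofracB loc_pred_tofrac.
  - by rewrite -tofracM loc_pred_tofrac.
have nzF N : tofrac F ^+ N != 0 by rewrite expf_neq0 // tofrac_eq0.
split=> [|_ _ /loc_predP[a [N ->]] /loc_predP[b [M ->]]
         |_ _ /loc_predP[a [N ->]] /loc_predP[b [M ->]]]; apply/loc_predP.
- by exists 1, 0; rewrite expr0 divr1 tofrac1.
- exists (a * F ^+ M - b * F ^+ N), (N + M).
  rewrite tofracB !tofracM !tofracXn exprD.
  by rewrite -mulNr addf_div // mulNr.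
- by exists (a * b), (N + M); rewrite tofracM exprD invfM mulrACA.
Qed.

HB.instance Definition _ :=
  GRing.isSubringClosed.Build {fraction A} loc_pred loc_subring_closed.

Record loc := Loc { loc_val : {fraction A}; loc_valP : loc_val \in loc_pred }.

HB.instance Definition _ := [isSub for loc_val].
HB.instance Definition _ := [Choice of loc by <:].
HB.instance Definition _ := [SubChoice_isSubComNzRing of loc by <:].

Lemma locfrac_subproof (a : A) (N : nat) :
  tofrac a / tofrac F ^+ N \in loc_pred.
Proof. by apply/loc_predP; exists a, N. Qed.

(* a / F ^+ N *)
Definition locfrac a N : loc := Loc (locfrac_subproof a N).

End Localization.

(* The derivation d/dx_k of R[x_1, ..., x_n][1/F]. *)
Section LocDerivation.
Variables (n : nat) (R : idomainType).

(* The quotient rule on a chosen representative; by fracD_div any other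
   representative gives the same value. *)
Definition fracD (k : 'I_n) (g : {fraction {mpoly R[n]}}) :=
  let a := \n_(repr g) in let b := \d_(repr g) in
  tofrac (a^`M(k) * b - a * b^`M(k)) / tofrac b ^+ 2.

Lemma fracD_div k (a b : {mpoly R[n]}) : b != 0 ->
  fracD k (tofrac a / tofrac b)
  = tofrac (a^`M(k) * b - a * b^`M(k)) / tofrac b ^+ 2.
Proof.
move=> b0; rewrite /fracD.
set g := tofrac a / tofrac b.
have d0 : \d_(repr g) != 0 by exact: denom_ratioP.
have gE : g = tofrac \n_(repr g) / tofrac \d_(repr g).
  by rewrite -frac_numden reprK.
move: (\n_(repr g)) (\d_(repr g)) d0 gE => c d d0 gE.
have /esym e : a * d = c * b by apply/frac_eq_cross.
have e' : c^`M(k) * b + c * b^`M(k) = a^`M(k) * d + a * d^`M(k).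
  by rewrite -!mderivM e.
rewrite -!tofracXn; apply/frac_eq_cross; rewrite ?expf_neq0 //.
exact: quotient_rule_wd.
Qed.

Lemma fracD_tofrac k (a : {mpoly R[n]}) : fracD k (tofrac a) = tofrac (a^`M(k)).
Proof.
rewrite -[tofrac a]divr1 -tofrac1 fracD_div ?oner_eq0 //.
by rewrite mderivC mulr0 mulr1 subr0 tofrac1 expr1n divr1.
Qed.

Variable F : {mpoly R[n]}.

Lemma locD_subproof k (u : loc F) : fracD k (val u) \in loc_pred F.
Proof.
case: u => g /= gP; have [F0|F0] := eqVneq F 0.
  have [a ->] := loc_pred_degenerate F0 gP.
  by rewrite fracD_tofrac loc_pred_tofrac.
case/loc_predP: gP => a [N ->].
rewrite -tofracXn fracD_div ?expf_neq0 // tofracXn -exprM.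
by apply/loc_predP; exists (a^`M(k) * F ^+ N - a * (F ^+ N)^`M(k)), (N * 2)%N.
Qed.

Definition locD k (u : loc F) : loc F := Loc (locD_subproof k u).

End LocDerivation.

(* The twisted module of h_1^s_1 ... h_p^s_p, for a family h of polynomials
   over a domain R and scalars s_i in R. *)
Section PowerModule.
Variables (n p : nat) (R : idomainType).
Variables (s : 'I_p -> R) (h : 'I_p -> {mpoly R[n]}).

Definition hprod : {mpoly R[n]} := \prod_i h i.

(* Free of rank one over R[x][1/(h_1 ... h_p)]: g : power_module stands for
   g h_1^s_1 ... h_p^s_p. *)
Definition power_module := loc hprod.

Definition poly_loc (a : {mpoly R[n]}) : power_module := locfrac hprod a 0.

(* (d h_i / d x_k) / h_i *)
Definition dlog k i : power_module :=
  locfrac hprod ((h i)^`M(k) * \prod_(j | j != i) h j) 1.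

(* d/dx_k (g h^s) = (d g / d x_k + g \sum_i s_i (d h_i / d x_k) / h_i) h^s *)
Definition nabla k (g : power_module) : power_module :=
  locD k g + g * \sum_i poly_loc (s i)%:MP * dlog k i.

(* The action of d^m = d_1^m_1 ... d_n^m_n. *)
Definition nablaX (m : 'X_{1..n}) (g : power_module) : power_module :=
  foldr (fun k => iter (m k) (nabla k)) g (enum 'I_n).

(* The differential operators \sum_m P_m d^m with coefficients P_m in R[x]
   written on the left, encoded by the finitely supported family m |-> P@_m.
   The commutative product of this type is not the product of operators and
   is not used. *)
Definition weyl := {mpoly {mpoly R[n]}[n]}.

Definition weyl_act (P : weyl) (g : power_module) : power_module :=
  \sum_(m <- msupp P) poly_loc P@_m * nablaX m g.

Definition power_symbol : power_module := 1.

(* h_1^(s_1 + 1) ... h_p^(s_p + 1) *)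
Definition power_shift : power_module := poly_loc hprod * power_symbol.

End PowerModule.

(* K[x, s] is represented as K[s][x], so that mderiv is d/dx_k, and
   A_n(K)[s] is the ring of differential operators with coefficients in
   R[x] for R = K[s]. *)
Definition bernstein_ideal (n p : nat) (K : fieldType)
    (f : 'I_p -> {mpoly K[n]}) (b : {mpoly K[p]}) : Prop :=
  let s i : {mpoly K[p]} := 'X_i in
  let h i : {mpoly {mpoly K[p]}[n]} := map_mpoly (@mpolyC p K) (f i) in
  exists P : weyl n {mpoly K[p]},
    poly_loc h b%:MP * power_symbol h = weyl_act s P (power_shift h).

(* The linear form \sum_i v_i x_i. *)
Definition linear_form (n : nat) (K : fieldType) (v : 'rV[K]_n) : {mpoly K[n]} :=
  \sum_(i < n) v 0 i *: 'X_i.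

(* The rows of L are the coefficients of p linear forms on K^n. *)
Definition generic_family (n p : nat) (K : fieldType) (L : 'M[K]_(p, n)) :=
  forall g : 'I_n -> 'I_p, injective g -> \rank (rowsub g L) = n.

(* Main.v *)
Require Import Defs.
From HB Require Import structures.
From mathcomp Require Import all_boot all_order all_algebra.
From mathcomp Require Import fraction ring zify boolp reals complex mpoly.

(* For a set J of indices write l_J = \prod_(j in J) l_j, let N be the
   A_n[s]-module generated by l^(s+1), and m the ideal (x_1, ..., x_n).

   1. If #|J| = q < n and g is homogeneous of degree at least p - n - 1 + q,
      then \prod_(j in J) (s_j + 1) g l_{~J} l^s lies in N, by induction on q.
      Genericity reduces to two kinds of g.  If l_j divides g for some j in J,
      use J \ {j}.  If g = l_I' g' with I' disjoint from J and #|I'| = p - n,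
      pick j in J and the constant vector field v with v(l_j) = 1 and
      v(l_i) = 0 for the other i outside I'.  Applying v to g l_j l_{~J} l^s
      gives (s_j + 1) g l_{~J} l^s plus a multiple of l_j l_{~J} l^s of degree
      one less than g, so that the case of J \ {j} applies twice.
   2. The products of p - n + 1 of the forms span the polynomials of that
      degree, so the case q = n - 1 yields
      \prod_j (s_j + 1) m^(2p-n-1) l^s \subset N.
   3. For g homogeneous of degree d,
      \sum_k d_k x_k g l^s = (\sum_j s_j + n + d) g l^s,
      which descends from degree 2p - n - 1 to g = 1 at the cost of one factor
      per degree. *)

Set Implicit Arguments.
Unset Strict Implicit.
Unset Printing Implicit Defensive.

Import GRing.Theory.
Local Open Scope ring_scope.

Local Notation tofrac := (@FracField.tofrac _).

(** * Derivations of the fraction field of a polynomial ring *)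

Lemma quotient_ruleK (K : fieldType) (a b a' b' : K) : b != 0 ->
  (a' * b - a * b') / b ^+ 2 * b + a / b * b' = a'.
Proof. by move=> b0; field. Qed.

Section FractionDerivation.
Variables (n : nat) (R : idomainType).
Implicit Types (k : 'I_n) (x y : {fraction {mpoly R[n]}}).

Lemma fracP x : exists a b, b != 0 /\ x * tofrac b = tofrac a.
Proof.
exists (\n_(repr x))%qT, (\d_(repr x))%qT.
have d0 : (\d_(repr x))%qT != 0 by exact: denom_ratioP.
by split=> //; rewrite -{1}[x]reprK frac_numden divfK ?tofrac_eq0.
Qed.

(** Leibniz's rule for [x * b = a]. As [b] is nonzero, it determines [fracD k x] from any fraction
    representing [x], and the laws of a derivation follow by clearing denominators. *)
Lemma fracDE k x a b : b != 0 -> x * tofrac b = tofrac a ->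
  fracD k x * tofrac b + x * tofrac b^`M(k) = tofrac a^`M(k).
Proof.
move=> b0 xb; have fb : tofrac b != 0 by rewrite tofrac_eq0.
have -> : x = tofrac a / tofrac b by rewrite -xb mulfK.
rewrite (fracD_div k a b0) tofracB !tofracM.
exact: quotient_ruleK.
Qed.

Lemma fracDD k x y : fracD k (x + y) = fracD k x + fracD k y.
Proof.
have [a [b [b0 xb]]] := fracP x; have [c [d [d0 yd]]] := fracP y.
have fb : tofrac (b * d) != 0 by rewrite tofrac_eq0 mulf_neq0.
have xy : (x + y) * tofrac (b * d) = tofrac (a * d + c * b).
  by rewrite tofracD !tofracM -xb -yd; ring.
apply: (mulIf fb); have := fracDE k (mulf_neq0 b0 d0) xy.
move/(canRL (addrK _)) => ->; rewrite mderivD !mderivM !(tofracM, tofracD).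
by rewrite -(fracDE k b0 xb) -(fracDE k d0 yd) -xb -yd; ring.
Qed.

Lemma fracDM k x y : fracD k (x * y) = fracD k x * y + x * fracD k y.
Proof.
have [a [b [b0 xb]]] := fracP x; have [c [d [d0 yd]]] := fracP y.
have fb : tofrac (b * d) != 0 by rewrite tofrac_eq0 mulf_neq0.
have xy : (x * y) * tofrac (b * d) = tofrac (a * c).
  by rewrite !tofracM -xb -yd; ring.
apply: (mulIf fb); have := fracDE k (mulf_neq0 b0 d0) xy.
move/(canRL (addrK _)) => ->; rewrite !mderivM !(tofracM, tofracD).
by rewrite -(fracDE k b0 xb) -(fracDE k d0 yd) -xb -yd; ring.
Qed.

Lemma fracDB k x y : fracD k (x - y) = fracD k x - fracD k y.
Proof. by apply: (addIr (fracD k y)); rewrite -fracDD !subrK. Qed.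

Lemma fracD0 k : @fracD n R k 0 = 0.
Proof. by have := fracDB k 0 0; rewrite !subrr. Qed.

Lemma fracD_sum k I (r : seq I) (P : pred I)
    (F : I -> {fraction {mpoly R[n]}}) :
  fracD k (\sum_(i <- r | P i) F i) = \sum_(i <- r | P i) fracD k (F i).
Proof. exact: (big_morph (@fracD n R k) (fracDD k) (fracD0 k)). Qed.

(** Differentiating [x * b = a] twice expresses the second derivative of [x], times [b], by terms
    symmetric in the two indices, since partial derivatives of polynomials commute. *)
Lemma fracDC k l x : fracD k (fracD l x) = fracD l (fracD k x).
Proof.
have [a [b [b0 xb]]] := fracP x.
have fb : tofrac b != 0 by rewrite tofrac_eq0.
apply: (mulIf fb).
have D2 i j : fracD i (fracD j x) * tofrac b = tofrac a^`M(j)^`M(i)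
    - fracD j x * tofrac b^`M(i) - fracD i x * tofrac b^`M(j)
    - x * tofrac b^`M(j)^`M(i).
  rewrite -!(fracD_tofrac _ _^`M(_)) -!fracD_tofrac -xb.
  rewrite (fracDM j x) fracDD (fracDM i _ (tofrac b)) (fracDM i x).
  ring.
rewrite (D2 k l) (D2 l k) (mderiv_comm k l a) (mderiv_comm k l b).
by congr (_ - _); rewrite addrAC.
Qed.

(** The logarithmic differential dx/x is closed; this gives the flatness of the connection in
    [nablaC]. *)
Lemma fracD_dlogC k l x : x != 0 ->
  fracD k (fracD l x / x) = fracD l (fracD k x / x).
Proof.
move=> x0; apply: (mulIf x0).
have D i j : fracD i (fracD j x / x) * x
    = fracD i (fracD j x) - fracD i x * fracD j x / x.
  have : fracD i (fracD j x / x * x) = fracD i (fracD j x) by rewrite divfK.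
  rewrite fracDM => <-; ring.
by rewrite (D k l) (D l k) (fracDC k l) (mulrC (fracD k x)).
Qed.

End FractionDerivation.

(** * Values of elements of the localization *)

Section Localization.
Variables (A : idomainType) (F : A).
Implicit Types u v : loc F.

Lemma val_locD u v : val (u + v) = val u + val v. Proof. by []. Qed.
Lemma val_locM u v : val (u * v) = val u * val v. Proof. by []. Qed.
Lemma val_loc_sum I (r : seq I) (P : pred I) (G : I -> loc F) :
  val (\sum_(i <- r | P i) G i) = \sum_(i <- r | P i) val (G i).
Proof. by apply: (big_morph _ val_locD). Qed.
End Localization.

(** * Homogeneous polynomials *)

Section Homogeneous.
Variables (n : nat) (R : idomainType).
Implicit Types (k : 'I_n) (g : {mpoly R[n]}).

Lemma dhomog_ind d (P : {mpoly R[n]} -> Prop) :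
    P 0 -> (forall g g', P g -> P g' -> P (g + g')) ->
    (forall c m, mdeg m = d -> P (c *: 'X_[m])) ->
  forall g, g \is d.-homog -> P g.
Proof.
move=> P0 PD PX g /dhomogP hg; rewrite [g]mpolyE big_seq.
by apply: (big_ind P) => // m /hg; exact: PX.
Qed.

(** For [d = 0] the truncated predecessor is harmless: the derivative vanishes, and 0 is homogeneous
    of every degree. *)
Lemma dhomog_mderiv d k g : g \is d.-homog -> g^`M(k) \is d.-1.-homog.
Proof.
move: g; apply: dhomog_ind => [|g g'|c m dm]; first by rewrite mderiv0 dhomog0.
  by rewrite mderivD; exact: rpredD.
rewrite mderivZ mderivX; apply: rpredZ; have [->|mk] := eqVneq (m k) 0%N.
  by rewrite scale0r dhomog0.
have mE : m = (m - U_(k) + U_(k))%MM by rewrite submK // lep1mP.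
by apply: rpredZ; rewrite dhomogX -dm {2}mE mdegD mdeg1 addn1.
Qed.

Lemma dhomog_Euler d g :
  g \is d.-homog -> \sum_k 'X_k * g^`M(k) = (d%:R)%:MP * g.
Proof.
move: g; apply: dhomog_ind => [|g g' e e'|c m <-].
- by rewrite mulr0 big1 // => k _; rewrite mderiv0 mulr0.
- rewrite mulrDr -e -e' -big_split; apply: eq_bigr => k _.
  by rewrite mderivD mulrDr.
rewrite mdegE natr_sum rmorph_sum mulr_suml; apply: eq_bigr => k _.
rewrite mderivZ mderivX -!scalerAr mul_mpolyC; congr (_ *: _).
have [->|mk] := eqVneq (m k) 0%N; first by rewrite !scale0r.
by congr (_ *: _); rewrite -mpolyXD addmC submK // lep1mP.
Qed.

Lemma dhomog_split d g : g \is d.+1.-homog ->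
  exists2 G : 'I_n -> {mpoly R[n]}, forall k, G k \is d.-homog
    & g = \sum_k 'X_k * G k.
Proof.
move: g; apply: dhomog_ind => [|_ _ [G hG ->] [G' hG' ->]|c m dm].
- exists (fun=> 0); first by move=> k; exact: dhomog0.
  by rewrite big1 // => k _; rewrite mulr0.
- exists (fun k => G k + G' k); first by move=> k; exact: rpredD.
  by rewrite -big_split; apply: eq_bigr => k _; rewrite mulrDr.
(* A monomial of positive degree is divisible by some variable. *)
have [k mk] : exists k, m k != 0%N.
  apply/existsP; rewrite -negb_forall; apply/forallP => m0.
  by move: dm; rewrite mdegE big1 // => i _; exact/eqP/m0.
have mE : m = (m - U_(k) + U_(k))%MM by rewrite submK // lep1mP.
exists (fun j => if j == k then c *: 'X_[m - U_(k)] else 0) => [j|].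
  case: eqP => _; last exact: dhomog0.
  apply: rpredZ; rewrite dhomogX; apply/eqP/succn_inj.
  by rewrite -dm {2}mE mdegD mdeg1 addn1.
rewrite (bigD1 k) //= eqxx big1 ?addr0 => [|j /negPf ->]; last by rewrite mulr0.
by rewrite -scalerAr -mpolyXD addmC -mE.
Qed.

Lemma dhomog_prod1 (I : finType) (A : {set I}) (F : I -> {mpoly R[n]}) :
  (forall i, F i \is 1.-homog) -> \prod_(i in A) F i \is #|A|.-homog.
Proof.
move=> hF; rewrite -sum1_card; elim/big_rec2: _ => [|i d g _ hg].
  exact: dhomog1.
exact: dhomogM.
Qed.

End Homogeneous.

(** * The twisted module as a flat connection *)

Section PowerModule.
Variables (n p : nat) (R : idomainType).
Variables (s : 'I_p -> R) (h : 'I_p -> {mpoly R[n]}).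
Hypothesis h_neq0 : forall i, h i != 0.
Implicit Types (k l : 'I_n) (u : power_module h) (a b : {mpoly R[n]}).

Local Notation iota := (poly_loc h).
Local Notation nab := (@nabla n p R s h).
Local Notation nabX := (@nablaX n p R s h).

Lemma val_poly_loc a : val (iota a) = tofrac a.
Proof. by rewrite /= expr0 divr1. Qed.

Lemma poly_locD : {morph iota : a b / a + b}.
Proof. by move=> a b; apply: val_inj; rewrite val_locD !val_poly_loc tofracD. Qed.

Lemma poly_locM : {morph iota : a b / a * b}.
Proof. by move=> a b; apply: val_inj; rewrite val_locM !val_poly_loc tofracM. Qed.

Lemma poly_loc0 : iota 0 = 0.
Proof. by apply: val_inj; rewrite val_poly_loc tofrac0. Qed.

Lemma poly_loc1 : iota 1 = 1.
Proof. by apply: val_inj; rewrite val_poly_loc tofrac1. Qed.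

Lemma poly_loc_sum I (r : seq I) (P : pred I) G :
  iota (\sum_(i <- r | P i) G i) = \sum_(i <- r | P i) iota (G i).
Proof. exact: (big_morph _ poly_locD poly_loc0). Qed.

Lemma val_dlog k i : val (dlog h k i) = fracD k (tofrac (h i)) / tofrac (h i).
Proof.
pose P := \prod_(j | j != i) h j.
have P0 : tofrac P != 0.
  by rewrite tofrac_eq0 prodf_seq_neq0; apply/allP => j _; rewrite h_neq0 implybT.
have hE : hprod h = h i * P by exact: bigD1.
rewrite fracD_tofrac /= expr1 hE -/P (tofracM _ P) (tofracM _ P) invfM.
by rewrite mulrACA mulfV // mulr1.
Qed.

Lemma poly_loc_dlog k i : iota (h i) * dlog h k i = iota (h i)^`M(k).
Proof.
apply: val_inj; rewrite val_locM val_dlog !val_poly_loc fracD_tofrac.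
by rewrite mulrC divfK // tofrac_eq0.
Qed.

(** The coefficient at dx_k of the connection form \sum_i s_i dh_i/h_i, taken in the fraction field,
    where identities between rational functions are checked. *)
Definition conn k :=
  \sum_i tofrac (s i)%:MP * (fracD k (tofrac (h i)) / tofrac (h i)).

Lemma val_nabla k u : val (nab k u) = fracD k (val u) + val u * conn k.
Proof.
rewrite /nabla val_locD val_locM val_loc_sum; congr (_ + _ * _).
by apply: eq_bigr => i _; rewrite val_locM val_poly_loc val_dlog.
Qed.

Lemma nablaD k u u' : nab k (u + u') = nab k u + nab k u'.
Proof.
apply: val_inj; rewrite val_nabla [RHS]val_locD !val_nabla val_locD fracDD; ring.
Qed.

Lemma nabla0 k : nab k 0 = 0.
Proof.
by apply: (addrI (nab k 0)); rewrite -nablaD !addr0.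
Qed.

Lemma nabla_sum k I (r : seq I) (P : pred I) G :
  nab k (\sum_(i <- r | P i) G i) = \sum_(i <- r | P i) nab k (G i).
Proof. exact: (big_morph _ (nablaD k) (nabla0 k)). Qed.

Lemma nablaM k a u : nab k (iota a * u) = iota a^`M(k) * u + iota a * nab k u.
Proof.
apply: val_inj; rewrite val_nabla [RHS]val_locD !val_locM val_nabla !val_poly_loc.
by rewrite (fracDM k (tofrac a)) fracD_tofrac; ring.
Qed.

(** Flatness: the connection form is closed, since the [s i] are constants and each dh_i/h_i is
    closed. *)
Lemma nablaC k l u : nab k (nab l u) = nab l (nab k u).
Proof.
apply: val_inj; rewrite !val_nabla (fracDD k) (fracDD l).
rewrite (fracDM k (val u)) (fracDM l (val u)) (fracDC k l).
suff -> : fracD k (conn l) = fracD l (conn k) by ring.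
have conn_D i j : fracD i (conn j) = \sum_e tofrac (s e)%:MP *
    fracD i (fracD j (tofrac (h e)) / tofrac (h e)).
  rewrite fracD_sum; apply: eq_bigr => e _.
  by rewrite (fracDM i (tofrac (s e)%:MP)) fracD_tofrac mderivC tofrac0 mul0r add0r.
rewrite !conn_D; apply: eq_bigr => e _; rewrite fracD_dlogC //.
by rewrite tofrac_eq0.
Qed.

Lemma nabla_iterC k l e u : nab k (iter e (nab l) u) = iter e (nab l) (nab k u).
Proof. by elim: e => //= e IH; rewrite nablaC IH. Qed.

(** [nablaX] applies the derivations in the order of [enum]; by [nablaC] the new one can be moved to
    its place. *)
Lemma nabla_nablaX k m u : nab k (nabX m u) = nabX (m + U_(k))%MM u.
Proof.
rewrite /nablaX; have : k \in enum 'I_n by rewrite mem_enum.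
elim: (enum 'I_n) (enum_uniq 'I_n) => //= l r IH /andP[lr ur].
rewrite inE mnmDE mnmE; case: eqVneq => [-> _|_ /= kr].
  rewrite addn1 iterS; congr (nab l (iter _ _ _)).
  elim: r lr {IH ur} => //= j r IH; rewrite inE negb_or => /andP[lj lr].
  by rewrite mnmDE mnmE (negPf lj) addn0 IH.
by rewrite addn0 nabla_iterC IH.
Qed.

(** Allows two operators to be summed over a common list of exponents. *)
Lemma weyl_act_sub r (P : weyl n R) u : uniq r -> {subset msupp P <= r} ->
  weyl_act s P u = \sum_(m <- r) iota P@_m * nabX m u.
Proof.
move=> ur sPr; rewrite /weyl_act [RHS](bigID (mem (msupp P))) /=.
rewrite [X in _ + X]big1 ?addr0; last first.
  by move=> m mP; rewrite memN_msupp_eq0 // poly_loc0 mul0r.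
rewrite -[RHS]big_filter; apply: perm_big; apply: uniq_perm.
- exact: msupp_uniq.
- exact: filter_uniq.
- by move=> m; rewrite mem_filter; case: (boolP (m \in _)) => //= /sPr ->.
Qed.

Lemma weyl_actD (P Q : weyl n R) u :
  weyl_act s (P + Q) u = weyl_act s P u + weyl_act s Q u.
Proof.
pose r := undup (msupp P ++ msupp Q).
rewrite !(@weyl_act_sub r) ?undup_uniq //; first last.
- by move=> m /msuppD_le; rewrite mem_undup.
- by move=> m mP; rewrite mem_undup mem_cat mP.
- by move=> m mP; rewrite mem_undup mem_cat mP orbT.
by rewrite -big_split; apply: eq_bigr => m _; rewrite mcoeffD poly_locD mulrDl.
Qed.

Lemma weyl_act_monomial a m u :
  weyl_act s (a *: 'X_[m] : weyl n R) u = iota a * nabX m u.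
Proof.
rewrite (@weyl_act_sub [:: m]) //; last first.
  by move=> m' /msuppZ_le; rewrite msuppX.
by rewrite big_seq1 mcoeffZ mcoeffX eqxx mulr1.
Qed.

Lemma poly_loc_reg i u : iota (h i) * u = 0 -> u = 0.
Proof.
move=> hu; apply: val_inj; have /(congr1 val) := hu.
rewrite val_locM val_poly_loc => /eqP.
by rewrite mulf_eq0 tofrac_eq0 (negPf (h_neq0 i)) => /eqP.
Qed.

Implicit Types (v w : 'I_n -> {mpoly R[n]}).

(** Here [v] is the vector field \sum_k v_k d_k with polynomial coefficients; [vder], [vdlog] and
    [vnabla] are its actions on polynomials, on log h_i and on the twisted module. *)
Definition vder v a := \sum_k v k * a^`M(k).
Definition vdlog v i := \sum_k iota (v k) * dlog h k i.
Definition vnabla v u := \sum_k iota (v k) * nab k u.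

Lemma vderC v c : vder v c%:MP = 0.
Proof. by apply: big1 => k _; rewrite mderivC mulr0. Qed.

Lemma vderM v a b : vder v (a * b) = vder v a * b + a * vder v b.
Proof.
rewrite mulr_suml mulr_sumr -big_split; apply: eq_bigr => k _ /=.
by rewrite mderivM; ring.
Qed.

Lemma vder_prod0 v (I : finType) (A : {set I}) (F : I -> {mpoly R[n]}) :
  (forall i, i \in A -> vder v (F i) = 0) -> vder v (\prod_(i in A) F i) = 0.
Proof.
move=> F0; apply: (big_ind (fun a => vder v a = 0)) => //; first exact: vderC.
by move=> a b a0 b0; rewrite vderM a0 b0 mul0r mulr0 addr0.
Qed.

Lemma poly_loc_vdlog v i : iota (h i) * vdlog v i = iota (vder v (h i)).
Proof.
rewrite mulr_sumr poly_loc_sum; apply: eq_bigr => k _.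
by rewrite mulrCA poly_loc_dlog poly_locM.
Qed.

Lemma vdlog0 v i : vder v (h i) = 0 -> vdlog v i = 0.
Proof.
by move=> v0; apply: (@poly_loc_reg i); rewrite poly_loc_vdlog v0 poly_loc0.
Qed.

Lemma vdlog1 v i : vder v (h i) = h i -> vdlog v i = 1.
Proof.
move=> v1; apply/eqP; rewrite -subr_eq0; apply/eqP/(@poly_loc_reg i).
by rewrite mulrBr poly_loc_vdlog v1 mulr1 subrr.
Qed.

Lemma nabla_poly_loc k a :
  nab k (iota a) = iota a^`M(k) + iota a * \sum_i iota (s i)%:MP * dlog h k i.
Proof.
rewrite /nabla; congr (_ + _); apply: val_inj.
change (fracD k (val (iota a)) = val (iota a^`M(k))).
by rewrite !val_poly_loc fracD_tofrac.
Qed.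

(** The hypothesis says that [a] cancels the poles of all v(h_i)/h_i, so that the result is again a
    polynomial times the power symbol. *)
Lemma vnabla_poly_loc v a (w : 'I_p -> {mpoly R[n]}) :
    (forall i, iota a * vdlog v i = iota (w i)) ->
  vnabla v (iota a) = iota (vder v a + \sum_i (s i)%:MP * w i).
Proof.
move=> aw; rewrite poly_locD !poly_loc_sum /vnabla.
under eq_bigr do rewrite nabla_poly_loc mulrDr -poly_locM.
rewrite big_split; congr (_ + _) => /=.
under [RHS]eq_bigr do rewrite poly_locM -aw.
under eq_bigr do rewrite mulrCA.
rewrite -mulr_sumr; under [RHS]eq_bigr do rewrite mulrCA.
rewrite -[RHS]mulr_sumr; congr (_ * _).
under eq_bigr do rewrite mulr_sumr.
rewrite exchange_big; apply: eq_bigr => i _ /=.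
by rewrite mulr_sumr; apply: eq_bigr => k _; rewrite mulrCA.
Qed.

Definition euler_field k : {mpoly R[n]} := 'X_k.

(** Commuting d_k past x_k for every k contributes [n]; the Euler field then contributes [d] from
    [a] and [s i] from each [h i], as the [h i] are of degree 1. *)
Lemma nabla_Euler d a : (forall i, h i \is 1.-homog) -> a \is d.-homog ->
  \sum_k nab k (iota ('X_k * a)) = iota ((\sum_i s i + (n + d)%:R)%:MP * a).
Proof.
move=> hh ha.
have vE e b : b \is e.-homog -> vder euler_field b = (e%:R)%:MP * b.
  exact: dhomog_Euler.
have vh i : vder euler_field (h i) = h i by rewrite (vE _ _ (hh i)) mul1r.
have -> : \sum_k nab k (iota ('X_k * a))
    = iota (n%:R%:MP * a) + vnabla euler_field (iota a).
  under eq_bigr => k _.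
    rewrite poly_locM nablaM mderivX mnm1E eqxx scale1r.
    rewrite -[X in (X - _)%MM]add0m addmK mpolyX0 -poly_locM mul1r; over.
  rewrite big_split; congr (_ + _) => /=.
  by rewrite -poly_loc_sum sumr_const card_ord rmorph_nat mulr_natl.
rewrite (@vnabla_poly_loc _ _ (fun=> a)) => [|i]; last by rewrite vdlog1 ?mulr1.
rewrite -poly_locD; congr iota; rewrite (vE _ _ ha) -mulr_suml.
by rewrite -!mulrDl -!rmorph_sum -!rmorphD /= natrD addrA [X in X%:MP * _]addrC.
Qed.

(** * The submodule generated by one element *)

Variable u0 : power_module h.

(** Products of operators are never formed: closure under polynomial multiplication and under each
    [nabla] is enough. *)
Definition cyclic u := exists P : weyl n R, u = weyl_act s P u0.

Lemma cyclicD u u' : cyclic u -> cyclic u' -> cyclic (u + u').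
Proof. by case=> P -> [Q ->]; exists (P + Q); rewrite weyl_actD. Qed.

Lemma cyclic0 : cyclic 0.
Proof. by exists 0; rewrite /weyl_act msupp0 big_nil. Qed.

Lemma cyclic_sum I (r : seq I) (P : pred I) G :
  (forall i, P i -> cyclic (G i)) -> cyclic (\sum_(i <- r | P i) G i).
Proof. by move=> cG; apply: big_ind cG => //; [exact: cyclic0 | exact: cyclicD]. Qed.

Lemma cyclicM a u : cyclic u -> cyclic (iota a * u).
Proof.
case=> P ->; rewrite mulr_sumr; apply: cyclic_sum => m _.
by exists ((a * P@_m) *: 'X_[m]); rewrite weyl_act_monomial poly_locM mulrA.
Qed.

Lemma cyclic_nabla k u : cyclic u -> cyclic (nab k u).
Proof.
case=> P ->; rewrite nabla_sum; apply: cyclic_sum => m _; rewrite nablaM.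
(* The two terms of d_k P = (dP/dx_k) + P d_k. *)
apply: cyclicD.
  by exists ((P@_m)^`M(k) *: 'X_[m]); rewrite weyl_act_monomial.
by exists (P@_m *: 'X_[m + U_(k)]); rewrite weyl_act_monomial nabla_nablaX.
Qed.

Lemma cyclic_vnabla v u : cyclic u -> cyclic (vnabla v u).
Proof.
by move=> cu; apply: cyclic_sum => k _; apply/cyclicM/cyclic_nabla.
Qed.

Lemma cyclic_gen : cyclic u0.
Proof.
exists (1 *: 'X_[0%MM]); rewrite weyl_act_monomial poly_loc1 mul1r /nablaX.
by elim: (enum 'I_n) => //= k r <-; rewrite mnm0E.
Qed.

End PowerModule.

Lemma exists_set_between (T : finType) (A B : {set T}) m :
  A \subset B -> (#|A| <= m <= #|B|)%N ->
  exists C : {set T}, [/\ A \subset C, C \subset B & #|C| = m].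
Proof.
move=> sAB /andP[]; elim: m => [|m IH] lm ml.
  by exists A; split=> //; apply/eqP; rewrite -leqn0.
move: lm; rewrite leq_eqVlt => /predU1P[<-|lm]; first by exists A.
have [C [sAC sCB cC]] := IH lm (ltnW ml).
have /subsetPn[x xB xC] : ~~ (B \subset C).
  by apply/negP => /subset_leq_card; rewrite cC leqNgt ml.
exists (x |: C); split; last by rewrite cardsU1 xC cC.
  exact: subset_trans sAC (subsetUr _ _).
by rewrite subUset sub1set xB.
Qed.

(** * Linear forms and dual bases *)

Section Forms.
Variables (n p : nat) (R : idomainType) (L : 'M[R]_(p, n)).

Definition row_form j : {mpoly R[n]} := \sum_(k < n) L j k *: 'X_k.

Lemma row_form_homog j : row_form j \is 1.-homog.
Proof.
by apply: rpred_sum => k _; apply: rpredZ; rewrite dhomogX /= mdeg1.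
Qed.

Lemma mderiv_row_form k j : (row_form j)^`M(k) = (L j k)%:MP.
Proof.
rewrite /row_form raddf_sum (bigD1 k) //= big1 ?addr0 => [|i ik].
  rewrite mderivZ mderivX mnm1E eqxx scale1r -[X in (X - _)%MM]add0m addmK.
  by rewrite mpolyX0 -mul_mpolyC mulr1.
by rewrite mderivZ mderivX mnm1E (negPf ik) scale0r scaler0.
Qed.

(* Any n of the rows form a basis of R^n; c is the dual basis. *)
Definition rows_dual := forall T : {set 'I_p}, #|T| = n ->
  exists c : 'I_p -> 'I_n -> R,
    {in T &, forall i j, \sum_k L i k * c j k = (i == j)%:R} /\
    (forall k k', \sum_(j in T) c j k * L j k' = (k == k')%:R).

Hypothesis dualL : rows_dual.

Definition row_prod (A : {set 'I_p}) := \prod_(i in A) row_form i.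

(** The dual basis writes each variable as a combination of the forms of [T]. *)
Lemma dhomog_row_split (T : {set 'I_p}) d g : #|T| = n -> g \is d.+1.-homog ->
  exists2 G : 'I_p -> {mpoly R[n]}, forall j, G j \is d.-homog
    & g = \sum_(j in T) row_form j * G j.
Proof.
move=> cT /dhomog_split[G hG ->]; have [c [_ cL]] := dualL cT.
exists (fun j => \sum_k c j k *: G k) => [j /=|].
  by apply: rpred_sum => k _; apply: rpredZ; exact: hG.
under [RHS]eq_bigr do rewrite mulr_sumr.
rewrite exchange_big; apply: eq_bigr => k _ /=.
under eq_bigr do rewrite -scalerAr scalerAl.
rewrite -mulr_suml; congr (_ * _); rewrite /row_form.
under eq_bigr do rewrite scaler_sumr.
rewrite exchange_big (bigD1 k) //= [X in _ = _ + X]big1 ?addr0 => [|i ik].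
  by under eq_bigr do rewrite scalerA; rewrite -scaler_suml cL eqxx scale1r.
under eq_bigr do rewrite scalerA.
by rewrite -scaler_suml cL eq_sym (negPf ik) scale0r.
Qed.

(* By induction on #|I|: a product of k distinct rows in I either avoids a given
   row i, so that i may be moved to J, or contains it and has k - 1 other
   factors. *)
Lemma dhomog_row_ind (I J : {set 'I_p}) k e (P : {mpoly R[n]} -> Prop) :
    [disjoint I & J] -> (#|J| <= n)%N -> (n + k <= #|I| + #|J| + 1)%N ->
    P 0 -> (forall g g', P g -> P g' -> P (g + g')) ->
    (forall j d g, j \in J -> d.+1 = (e + k)%N -> g \is d.-homog ->
       P (row_form j * g)) ->
    (forall (I' : {set 'I_p}) g, I' \subset I -> #|I'| = k -> g \is e.-homog ->
       P (row_prod I' * g)) ->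
  forall g, g \is (e + k).-homog -> P g.
Proof.
move: {2}#|I| (erefl #|I|) => m.
elim: m I J k P => [|m IH] I J [|k] P cI dIJ cJ leI P0 PD PJ PI g hg.
- move: (PI set0 g); rewrite sub0set cards0 /row_prod big_set0 mul1r.
  by apply; rewrite // addn0 in hg *.
(* With [I] empty, the bound on the cardinals forces [J] to have [n] elements, so that its forms
   span all linear forms. *)
- have cJn : #|J| = n by lia.
  rewrite addnS in hg; have [G hG ->] := dhomog_row_split cJn hg.
  by apply: big_ind => // j jJ; apply: (PJ j (e + k)%N); rewrite ?addnS.
- move: (PI set0 g); rewrite sub0set cards0 /row_prod big_set0 mul1r.
  by apply; rewrite // addn0 in hg *.
have [cJn|cJn] := eqVneq #|J| n.
  rewrite addnS in hg; have [G hG ->] := dhomog_row_split cJn hg.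
  by apply: big_ind => // j jJ; apply: (PJ j (e + k)%N); rewrite ?addnS.
have [i iI] : exists i, i \in I by apply/set0Pn; rewrite -card_gt0 cI.
have iJ : i \notin J by have /pred0P/(_ i) := dIJ; rewrite /= iI /= => ->.
have cI' : #|I :\ i| = m by move: cI; rewrite (cardsD1 i) iI => -[].
have dI'J : [disjoint I :\ i & J].
  by apply: disjointWl dIJ; exact: subD1set.
(* Moving [i] from [I] to [J] keeps the sum of the cardinals, hence the bound. *)
move: g hg; apply: (IH (I :\ i) (i |: J)) => //.
- rewrite -setI_eq0 setIUr setU_eq0 !setI_eq0 dI'J andbT.
  by rewrite disjoint_sym disjoints1 !inE eqxx.
- by rewrite cardsU1 iJ; lia.
- by rewrite cardsU1 iJ; lia.
- move=> j d g; rewrite !inE => /orP[/eqP -> dE hg|jJ]; last exact: PJ.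
  have {}hg : g \is (e + k).-homog by move: dE; rewrite addnS => -[<-].
  move: g hg {dE d j}.
  (* For multiples of [row_form i], the row [i] counts as one chosen factor: [k] others remain to be
     taken from [I :\ i]. *)
  apply: (IH (I :\ i) J k (fun g => P (row_form i * g))) => //.
  - by lia.
  - by rewrite mulr0.
  - by move=> g g'; rewrite mulrDr; exact: PD.
  - move=> j d g jJ dE hg; rewrite mulrCA; apply: (PJ j d.+1) => //; first lia.
    by rewrite -add1n; apply: dhomogM => //; exact: row_form_homog.
  move=> I' g sI' cI'' hg; have iI' : i \notin I'.
    by apply/negP => /(subsetP sI'); rewrite !inE eqxx.
  rewrite mulrA /row_prod -big_setU1 //; apply: PI => //.
    by rewrite subUset sub1set iI (subset_trans sI') // subD1set.
  by rewrite cardsU1 iI' cI''.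
move=> I' g sI'; apply: PI; exact: subset_trans sI' (subD1set _ _).
Qed.

(** Row [j] lies in some set of [n] rows, and pairs to 1 with its dual vector. *)
Lemma row_form_neq0 : (0 < n)%N -> (n <= p)%N -> forall j, row_form j != 0.
Proof.
move=> n0 np j.
have [|T [jT _ cT]] := @exists_set_between _ [set j] setT n (subsetT _).
  by rewrite cards1 n0 cardsT card_ord.
rewrite sub1set in jT; have [c [cL _]] := dualL cT.
apply/eqP => j0; have := cL j j jT jT; rewrite eqxx.
have L0 k : L j k = 0.
  have := mderiv_row_form k j; rewrite j0 mderiv0 => /esym/eqP.
  by rewrite mpolyC_eq0 => /eqP.
by rewrite big1 => [/eqP|k _]; rewrite ?L0 ?mul0r // eq_sym oner_eq0.
Qed.

End Forms.

Lemma generic_rows_dual (K : fieldType) n p (L : 'M[K]_(p, n)) :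
  generic_family L -> rows_dual L.
Proof.
(* Replacing [n] by [#|T|] lets [enum_val] index the rows of a square matrix. *)
move=> genL T cT; move: L genL; case: n / cT => L genL.
pose g (a : 'I_#|T|) := enum_val a.
have Lu : rowsub g L \in unitmx.
  by rewrite -row_free_unit /row_free genL //; exact: enum_val_inj.
(* The dual vectors are the columns of the inverse matrix; the sum picks the column of [j], and is 0
   for [j] outside [T]. *)
pose c j k := \sum_a (g a == j)%:R * invmx (rowsub g L) k a.
have cE b k : c (g b) k = invmx (rowsub g L) k b.
  rewrite /c (bigD1 b) //= eqxx mul1r big1 ?addr0 // => a ab.
  by rewrite (inj_eq enum_val_inj) (negPf ab) mul0r.
exists c; split=> [i j iT jT|k k'].
  rewrite -(enum_rankK_in iT iT) -(enum_rankK_in iT jT) -!/(g _) (inj_eq enum_val_inj).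
  move: (enum_rank_in iT i) (enum_rank_in iT j) => a b.
  have /matrixP/(_ a b) := mulmxV Lu; rewrite !mxE => <-.
  by apply: eq_bigr => k _; rewrite mxE cE.
have /matrixP/(_ k k') := mulVmx Lu; rewrite !mxE => <-.
by rewrite big_enum_val; apply: eq_bigr => a _; rewrite -/(g a) cE mxE.
Qed.

(** Genericity is a rank condition over a field; its form by dual bases consists of identities and
    so passes to K[s]. *)
Lemma rows_dual_map (R R' : idomainType) (f : {rmorphism R -> R'}) n p
  (L : 'M[R]_(p, n)) : rows_dual L -> rows_dual (map_mx f L).
Proof.
move=> dualL T /dualL[c [cL Lc]]; exists (fun j k => f (c j k)); split.
  move=> i j iT jT; rewrite -(rmorph_nat f) -cL // rmorph_sum.
  by apply: eq_bigr => k _; rewrite mxE rmorphM.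
move=> k k'; rewrite -(rmorph_nat f) -Lc rmorph_sum.
by apply: eq_bigr => j _; rewrite mxE rmorphM.
Qed.

(** * Membership in N for a generic arrangement *)

Section GenericArrangement.
Variables (n p : nat) (R : idomainType) (L : 'M[R]_(p, n)) (s : 'I_p -> R).
Hypotheses (n_gt0 : (0 < n)%N) (lt_np : (n < p)%N) (dualL : rows_dual L).

Local Notation h := (row_form L).
Local Notation iota := (poly_loc h).
Local Notation prodh := (row_prod L).

(* g l^s lies in N. *)
Definition shifted g := cyclic s (power_shift h) (iota g).

Let h0 : forall j, h j != 0 := row_form_neq0 dualL n_gt0 (ltnW lt_np).

Lemma shiftedD g g' : shifted g -> shifted g' -> shifted (g + g').
Proof. by rewrite /shifted poly_locD; exact: cyclicD. Qed.

Lemma shifted0 : shifted 0.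
Proof. by rewrite /shifted poly_loc0; exact: cyclic0. Qed.

Lemma shiftedM a g : shifted g -> shifted (a * g).
Proof. by rewrite /shifted poly_locM; exact: cyclicM. Qed.

Lemma shifted_hprod : shifted (prodh setT).
Proof.
have hE : prodh setT = hprod h by apply: eq_bigl => j; rewrite in_setT.
have := cyclic_gen s (power_shift h).
by rewrite /shifted hE {2}/power_shift /power_symbol mulr1.
Qed.

Definition sfactor (J : {set 'I_p}) := \prod_(j in J) (s j + 1).

(** [e] is the excess over the least admissible degree p - n - 1 + q. It varies in the induction,
    being [e.+1] for the element that is differentiated and [e] for the remainder. *)
Lemma shifted_homog q (J : {set 'I_p}) e g :
    #|J| = q -> (q < n)%N -> g \is (e + q + (p - n).-1).-homog ->
  shifted ((sfactor J)%:MP * g * prodh (~: J)).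
Proof.
elim: q J e g => [|q IH] J e g cJ ltqn hg.
  have -> : J = set0 by apply/eqP; rewrite -cards_eq0 cJ.
  by rewrite setC0; apply/shiftedM/shifted_hprod.
have cCJ : (#|J| + #|~: J| = p)%N by rewrite cardsC card_ord.
have sJ j : j \in J -> sfactor J = (s j + 1) * sfactor (J :\ j).
  by move=> jJ; rewrite /sfactor (big_setD1 j).
have CJ j : j \in J -> prodh (~: (J :\ j)) = h j * prodh (~: J).
  move=> jJ; rewrite /row_prod (_ : ~: (J :\ j) = j |: ~: J) ?big_setU1 //.
    by rewrite inE negbK.
  by apply/setP => i; rewrite !inE; case: eqP.
have {}IH j e' g' : j \in J -> g' \is (e' + q + (p - n).-1).-homog ->
    shifted ((sfactor (J :\ j))%:MP * g' * (h j * prodh (~: J))).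
  move=> jJ hg'; rewrite -CJ //; apply: (IH _ e') => //; last exact: ltnW.
  by move: cJ; rewrite (cardsD1 j) jJ => -[].
pose P g' := shifted ((sfactor J)%:MP * g' * prodh (~: J)).
have {}hg : g \is (e + q + (p - n)).-homog.
  by rewrite (_ : _ + _ = e + q.+1 + (p - n).-1)%N //; lia.
move: g hg; apply: (@dhomog_row_ind _ _ _ _ dualL (~: J) J _ _ P); rewrite /P.
- by rewrite disjoint_sym disjoints_subset setCK.
- by rewrite cJ; exact: ltnW.
- by lia.
- by rewrite mulr0 mul0r; exact: shifted0.
- by move=> g g'; rewrite mulrDr mulrDl; exact: shiftedD.
(* The factor [h j] of the polynomial supplies the one missing from the complement of [J]. *)
- move=> j d g jJ dE hg; rewrite (sJ j jJ).
  have hg' : g \is (e + q + (p - n).-1).-homog.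
    by rewrite (_ : _ + _ = d)%N //; lia.
  have := shiftedM (s j + 1)%:MP (IH j e g jJ hg'); congr shifted.
  by rewrite mpolyCM; ring.
move=> I' g sI' cI' hg.
have [j jJ] : exists j, j \in J by apply/set0Pn; rewrite -card_gt0 cJ.
have cT : #|~: I'| = n by have := cardsC I'; rewrite card_ord; lia.
have jI' : j \notin I' by apply/negP => /(subsetP sI'); rewrite inE jJ.
have [c [cL _]] := dualL cT.
(* The constant vector field dual to [h j] in the basis indexed by [~: I']; [kap i] is its value on
   [h i]. *)
pose v k : {mpoly R[n]} := (c j k)%:MP.
pose kap i := \sum_k L i k * c j k.
have vh i : vder v (h i) = (kap i)%:MP.
  rewrite /vder /kap rmorph_sum; apply: eq_bigr => k _.
  by rewrite mderiv_row_form -mpolyCM mulrC.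
have kapE i : i \notin I' -> kap i = (i == j)%:R.
  by move=> iI'; rewrite /kap cL // inE.
have hv d (a : {mpoly R[n]}) : a \is d.+1.-homog -> vder v a \is d.-homog.
  move=> ha; apply: rpred_sum => k _; rewrite mul_mpolyC; apply: rpredZ.
  exact: (dhomog_mderiv k ha).
have vh0 i : i \notin I' -> i != j -> vder v (h i) = 0.
  by move=> iI' /negPf ij; rewrite vh kapE // ij mpolyC0.
pose b : {mpoly R[n]} := (sfactor (J :\ j))%:MP.
pose A := prodh I'; pose B := prodh (~: J); pose D i := prodh (I' :\ i).
have hA : A \is (p - n).-1.+1.-homog.
  rewrite prednK ?subn_gt0 // -cI'; exact/dhomog_prod1/row_form_homog.
have AD i : i \in I' -> A = h i * D i.
  by move=> iI'; rewrite /A /row_prod (big_setD1 i).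
have BE : B = A * prodh (~: J :\: I').
  rewrite /A /B /row_prod (big_setID I') /= (setIidPr sI'); congr (_ * _).
(* [v] is applied to this element. As [h j * B] is the product over the complement of [J :\ j], the
   induction hypothesis covers it. *)
pose a := b * (A * g * (h j * B)).
have sa : shifted a.
  rewrite /a mulrA; apply: (IH j e.+1) => //.
  rewrite (_ : _ + _ = (p - n).-1.+1 + (e + q))%N; last lia.
  exact: dhomogM.
have sva : cyclic s (power_shift h) (vnabla s v (iota a)).
  exact: cyclic_vnabla.
(* The poles of v(h_i)/h_i cancel: [a] is divisible by [h j] and by [h i] for [i] in [I'], and [v]
   kills the other forms. *)
pose w i := if i == j then b * (A * g) * B
  else if i \in I' then (kap i)%:MP * (b * (D i * g * (h j * B))) else 0.
have aw i : iota a * vdlog h v i = iota (w i).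
  have pull a' : a = h i * a' -> iota a * vdlog h v i = iota (a' * (kap i)%:MP).
    by move=> ->; rewrite poly_locM mulrAC poly_loc_vdlog // vh -poly_locM mulrC.
  rewrite /w; case: eqP => [ij|/eqP ij].
    rewrite (pull (b * (A * g) * B)) ?ij ?kapE ?eqxx ?mulr1 //.
    by rewrite /a; ring.
  case: ifPn => iI'; last by rewrite vdlog0 ?vh0 // mulr0 poly_loc0.
  by rewrite (pull (b * (D i * g * (h j * B)))) 1?mulrC // /a (AD i iI'); ring.
(* [B] is [A] times forms killed by [v]. *)
have vA : A * vder v B = vder v A * B.
  rewrite {1}BE vderM [X in A * (_ + A * X)](_ : _ = 0) ?mulr0 ?addr0.
    by rewrite BE; ring.
  apply: vder_prod0 => i; rewrite !inE => /andP[iI' iJ]; apply: vh0 => //.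
  by apply: contraNneq iJ => ->.
have vj : vder v (h j) = 1 by rewrite vh kapE // eqxx.
(* The cofactor of [b * (h j * B)] in the remainder; [g * vder v A] comes from v(B) through [vA]. *)
pose W := vder v (A * g) + g * vder v A
  + \sum_(i in I') (s i * kap i)%:MP * (D i * g).
have hW : W \is (e + q + (p - n).-1).-homog.
  apply: rpredD; first apply: rpredD.
  - apply: hv; rewrite (_ : _.+1 = (p - n).-1.+1 + (e + q))%N; last lia.
    exact: dhomogM.
  - by apply: dhomogM => //; exact: hv.
  apply: rpred_sum => i iI'; rewrite mul_mpolyC; apply: rpredZ.
  rewrite addnC; apply: dhomogM => //.
  rewrite (_ : (p - n).-1 = #|I' :\ i|); first exact/dhomog_prod1/row_form_homog.
  by rewrite -cI' (cardsD1 i) iI'.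
(* In the factor s_j + 1, s_j comes from [w j] and 1 from v(h_j) = 1. *)
have E : vder v a + \sum_i (s i)%:MP * w i
    = (sfactor J)%:MP * (A * g) * B + b * W * (h j * B).
  have -> : \sum_i (s i)%:MP * w i = (s j)%:MP * (b * (A * g) * B)
      + (\sum_(i in I') (s i * kap i)%:MP * (D i * g)) * (b * (h j * B)).
    rewrite (bigD1 j) //= {1}/w eqxx; congr (_ + _).
    rewrite mulr_suml big_mkcond [RHS]big_mkcond /=; apply: eq_bigr => i _.
    rewrite /w; case: eqVneq => [->|ij] /=; first by rewrite (negPf jI').
    by case: ifP => _; rewrite ?mulr0 // mpolyCM; ring.
  rewrite /a !(vderM v b, vderM v (A * g), vderM v (h j)) vderC vj mul0r add0r mul1r.
  rewrite (_ : A * g * (B + h j * vder v B) = A * g * B + g * h j * (A * vder v B));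
    last by ring.
  rewrite vA (sJ j jJ) mpolyCM mpolyCD mpolyC1 /W -/b; ring.
have -> : (sfactor J)%:MP * (A * g) * B
    = vder v a + \sum_i (s i)%:MP * w i + (-1) * (b * W * (h j * B)).
  by rewrite E; ring.
apply: shiftedD; last by apply/shiftedM/(IH j e).
by rewrite /shifted -(vnabla_poly_loc s aw).
Qed.

Lemma shifted_top g : g \is (2 * p - n - 1).-homog ->
  shifted ((sfactor setT)%:MP * g).
Proof.
pose P g' := shifted ((sfactor setT)%:MP * g').
have -> : (2 * p - n - 1 = (p - 2) + (p - n).+1)%N by lia.
(* With [J] empty only products of p - n + 1 distinct forms remain; the complement of their index
   set has n - 1 elements. *)
move: g; apply: (@dhomog_row_ind _ _ _ _ dualL setT set0 _ _ P); rewrite /P.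
- by rewrite disjoint_sym disjoints_subset sub0set.
- by rewrite cards0.
- by rewrite cards0 cardsT card_ord; lia.
- by rewrite mulr0; exact: shifted0.
- by move=> g g'; rewrite mulrDr; exact: shiftedD.
- by move=> j d g; rewrite inE.
move=> I' g _ cI' hg.
have cJ : #|~: I'| = n.-1 by have := cardsC I'; rewrite card_ord; lia.
have : shifted ((sfactor (~: I'))%:MP * g * prodh (~: ~: I')).
  apply: (@shifted_homog n.-1 _ 0); rewrite ?prednK //.
  by rewrite (_ : _ + _ = p - 2)%N //; lia.
rewrite setCK => /(shiftedM (sfactor I')%:MP); congr shifted.
rewrite [sfactor setT](_ : _ = sfactor I' * sfactor (~: I')).
  by rewrite mpolyCM; ring.
by rewrite /sfactor (big_setID I') /= setTI setTD.
Qed.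

(** Induction on [t], the distance of the degree [m] from the top degree. *)
Lemma shifted_const m t g : (t <= 2 * p - n - 1)%N -> m = (2 * p - n - 1 - t)%N ->
    g \is m.-homog ->
  shifted ((sfactor setT * \prod_(m <= k < 2 * p - n - 1)
     (\sum_j s j + (n + k)%:R))%:MP * g).
Proof.
elim: t m g => [|t IH] m g ht mE hg.
  rewrite mE subn0 big_geq // mulr1; apply: shifted_top; by rewrite mE subn0 in hg.
rewrite big_ltn; last by lia.
set B := \prod_(_ <= k < _) _.
have -> : (sfactor setT * ((\sum_j s j + (n + m)%:R) * B))%:MP * g
    = (\sum_j s j + (n + m)%:R)%:MP * ((sfactor setT * B)%:MP * g).
  by rewrite !mpolyCM; ring.
have hg' : (sfactor setT * B)%:MP * g \is m.-homog.
  by rewrite mul_mpolyC; apply: rpredZ.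
(* Euler's identity read backwards turns the factor at degree [m] into a sum of derivatives of
   elements of degree [m.+1]. *)
rewrite /shifted -(nabla_Euler s h0 (row_form_homog L) hg').
apply: cyclic_sum => k _; apply: cyclic_nabla => //.
have := IH m.+1 ('X_k * g) (ltnW ht); rewrite /shifted mulrCA; apply; first lia.
by rewrite -add1n; apply: dhomogM => //; rewrite dhomogX /= mdeg1.
Qed.

End GenericArrangement.

(** * Extension of scalars to K[s] and conclusion *)

Lemma map_linear_form (K : fieldType) (n p : nat) (L : 'M[K]_(p, n)) j :
  map_mpoly (@mpolyC p K) (linear_form (row j L))
  = row_form (map_mx (@mpolyC p K) L) j.
Proof.
rewrite /linear_form rmorph_sum; apply: eq_bigr => k _.
by rewrite -!mul_mpolyC rmorphM /= map_mpolyC map_mpolyX !mxE.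
Qed.

Theorem proposition1 (R : realType) (n p : nat) (L : 'M[R[i]]_(p, n))
    (n_gt0 : (0 < n)%N) (le_n1p : (n + 1 <= p)%N) (genL : generic_family L) :
  bernstein_ideal (fun j => linear_form (row j L))
    ((\prod_(j < p) ('X_j + 1)) *
     \prod_(0 <= k < (2 * (p - n) + n - 2).+1)
       (\sum_(j < p) 'X_j + (n + k)%:R)).
Proof.
rewrite /bernstein_ideal.
rewrite (_ : (fun j => _) = row_form (map_mx (@mpolyC p R[i]) L)); last first.
  by apply/funext => j; exact: map_linear_form.
have lt_np : (n < p)%N by rewrite -addn1.
have dualL := rows_dual_map (@mpolyC p R[i]) (generic_rows_dual genL).
pose s (j : 'I_p) : {mpoly R[i][p]} := 'X_j.
(* Descent from the top degree down to degree 0, with [g = 1]. *)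
have := shifted_const s n_gt0 lt_np dualL (leqnn _) (esym (subnn _)) (@dhomog1 _ _ _).
rewrite mulr1 /shifted /power_symbol mulr1.
(* Since 0 < n < p, no subtraction truncates; the successor makes the upper bound of the product
   inclusive. *)
rewrite (_ : 2 * p - n - 1 = (2 * (p - n) + n - 2).+1)%N; last lia.
by rewrite /sfactor; under eq_bigl do rewrite in_setT.
Qed.
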